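(* Let $p\in(0,\infty)$ and $\gamma\in(0,\infty)$. There exist constants $0<c\le C<\infty$ depending only on $p$ and $\gamma$ such that for every $r$ with $0<r<1/6$, $$c\, r^d\,[\log(1/r)]^{p\gamma}\le [\mathbf{1}_{B_r}]_{X^{\gamma,p}}^p\le C\, r^d\,[\log(1/r)]^{p\gamma}.$$
   Context: $B_r$ is the Euclidean ball of radius $r$ centered at the origin of $\mathbb{R}^d$, $d\ge1$, and $\mathbf{1}_{B_r}$ is its indicator function. For a measurable function $f$ on $\mathbb{R}^d$, $$[f]_{X^{\gamma,p}}:=\left(\int_{B_{1/3}}\int_{\mathbb{R}^d}\frac{|f(x+h)-f(x)|^p}{|h|^d}\,\frac{1}{[\log(1/|h|)]^{1-p\gamma}}\,dx\,dh\right)^{1/p}.$$ *)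

(* Defs.v *)
From HB Require Import structures.
From mathcomp Require Import all_boot all_order all_algebra.
From mathcomp Require Import all_classical all_reals all_analysis.

Set Implicit Arguments.
Unset Strict Implicit.
Unset Printing Implicit Defensive.

Import Order.TTheory GRing.Theory Num.Theory.
Import numFieldNormedType.Exports.

Local Open Scope classical_set_scope.
Local Open Scope ring_scope.

Definition rV_display : measure_display.
Proof. exact: default_measure_display. Qed.

(* The Borel sigma-algebra of R^n, generated by the coordinate functions, as
   the library does for n.-tuple. *)
Section measurable_rV.
Context {R : realType}.
Variable n : nat.

Let coord : 'I_n -> 'rV[R]_n -> measurableTypeR R := fun i x => x ord0 i.

Let rV_set0 : g_sigma_preimage coord set0.
Proof. exact: sigma_algebra0. Qed.

Let rV_setC A : g_sigma_preimage coord A -> g_sigma_preimage coord (~` A).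
Proof. exact: sigma_algebraC. Qed.

Let rV_bigcup (F : _^nat) : (forall i, g_sigma_preimage coord (F i)) ->
  g_sigma_preimage coord (\bigcup_i (F i)).
Proof. exact: sigma_algebra_bigcup. Qed.

HB.instance Definition _ :=
  @isMeasurable.Build rV_display
  'rV[R]_n (g_sigma_preimage coord) rV_set0 rV_setC rV_bigcup.

End measurable_rV.

Section measurable_rV_theory.
Context {R : realType}.

Lemma measurable_rV_coord n (i : 'I_n) :
  measurable_fun setT (fun x : 'rV[R]_n => x ord0 i : measurableTypeR R).
Proof.
move=> _ Y mY; rewrite setTI; apply: sub_sigma_algebra => /=.
rewrite -bigcup_seq/=; exists i => /=; first by rewrite mem_index_enum.
by exists Y => //; rewrite setTI.
Qed.

Lemma measurable_fun_rVP d (T : measurableType d) n (f : T -> 'rV[R]_n) :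
  measurable_fun setT f <->
  forall i, measurable_fun setT (fun x => f x ord0 i : measurableTypeR R).
Proof.
split=> [mf i|mf].
  exact: (measurableT_comp (measurable_rV_coord i) mf).
move=> _ A mA; rewrite setTI.
pose G : set (set 'rV[R]_n) := [set A | measurable (f @^-1` A)].
apply: (mA G); split => [|B].
  split; first by rewrite /G/= preimage_set0.
  - by move=> B mB; rewrite /G/= setTD preimage_setC; exact: measurableC.
  - by move=> F mF; rewrite /G/= preimage_bigcup; exact: bigcupT_measurable.
rewrite -bigcup_seq => -[i _ [C mC <-]].
by rewrite /G/= !setTI; have := mf i measurableT C mC; rewrite setTI.
Qed.

Definition rV_cons n (x : measurableTypeR R * 'rV[R]_n) : 'rV[R]_n.+1 :=
  row_mx (const_mx x.1 : 'rV[R]_1) x.2.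

Lemma rV_cons0 n x : @rV_cons n x ord0 ord0 = x.1.
Proof.
by rewrite /rV_cons mxE; case: splitP => // j _; rewrite mxE.
Qed.

Lemma rV_consS n x i : @rV_cons n x ord0 (lift ord0 i) = x.2 ord0 i.
Proof.
rewrite /rV_cons mxE; case: splitP => j; first by rewrite ord1.
by move=> -[ij]; congr (_ _ _); exact/val_inj.
Qed.

Lemma measurable_rV_cons n : measurable_fun setT (@rV_cons n).
Proof.
apply/measurable_fun_rVP => i; case: (unliftP ord0 i) => [j|] ->.
  under eq_fun do rewrite rV_consS.
  exact: (measurableT_comp (measurable_rV_coord j) measurable_snd).
by under eq_fun do rewrite rV_cons0; exact: measurable_fst.
Qed.

End measurable_rV_theory.

Section lebesgue_rV.
Context {R : realType}.
Local Open Scope ereal_scope.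

(* Lebesgue measure on R^n: the iterated product of the Lebesgue measure on R,
   transported along R * R^n = R^n.+1; R^0 is a point of mass 1. *)
Fixpoint lebesgue_rV (n : nat) : set 'rV[R]_n -> \bar R :=
  match n with
  | 0 => \d_(0%R : 'rV[R]_0)
  | n'.+1 => pushforward (lebesgue_measure \x @lebesgue_rV n') (@rV_cons R n')
  end.

Let is_sfm n (mu : set 'rV[R]_n -> \bar R) :=
  [/\ mu set0 = 0, forall A, 0 <= mu A, semi_sigma_additive mu &
    forall k : nat, mu [set v | forall i, (`|v ord0 i| <= k%:R)%R] < +oo].

Let cube_measurable n (k : nat) :
  measurable [set v : 'rV[R]_n | forall i, (`|v ord0 i| <= k%:R)%R].
Proof.
rewrite (_ : [set _ | _] = \bigcap_(i in [set: 'I_n])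
   ((fun x : 'rV[R]_n => x ord0 i : measurableTypeR R) @^-1`
     `[(- k%:R)%R, (k%:R)%R]%classic)); last first.
  apply/seteqP; split => v /= vk i; first by rewrite /= in_itv/= -ler_norml.
  by have := vk i Logic.I; rewrite /= in_itv/= -ler_norml.
apply: fin_bigcap_measurable => // i _.
by rewrite -[X in measurable X]setTI; apply: measurable_rV_coord.
Qed.

Let cubes_setT n :
  [set: 'rV[R]_n] =
  \bigcup_k [set v : 'rV[R]_n | forall i, (`|v ord0 i| <= k%:R)%R].
Proof.
apply/esym; rewrite -subTset => v _.
exists (Num.truncn (\sum_i `|v ord0 i|)%R).+1 => // i /=.
apply: (@le_trans _ _ (\sum_i `|v ord0 i|)%R).
  by rewrite (bigD1 i)//= lerDl sumr_ge0.
by apply/ltW/truncnS_gt.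
Qed.

Let cubes_sigma_finite n (mu : set 'rV[R]_n -> \bar R) :
  is_sfm mu -> sigma_finite setT mu.
Proof.
case=> _ _ _ mufin.
exists (fun k => [set v : 'rV[R]_n | forall i, (`|v ord0 i| <= k%:R)%R]).
  exact: cubes_setT.
by move=> k; split; [exact: cube_measurable|exact: mufin].
Qed.

Let lebesgue_rV_sfm n : is_sfm (@lebesgue_rV n).
Proof.
elim: n => [|n IH].
  split => /=; [exact: measure0|by move=> A; exact: measure_ge0|
    exact: measure_semi_sigma_additive|].
  by move=> k; rewrite diracE ltry.
have [m0 mge0 madd mfin] := IH.
pose m_isM := isMeasure.Build _ _ _ _ m0 mge0 madd.
pose M : {measure set 'rV[R]_n -> \bar R} := HB.pack (@lebesgue_rV n) m_isM.
pose m_isSF := Measure_isSigmaFinite.Build _ _ _ M (cubes_sigma_finite IH).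
pose m : {sigma_finite_measure set 'rV[R]_n -> \bar R} :=
  HB.pack (M : set _ -> \bar R) M m_isSF.
pose lm : {measure set _ -> \bar R} := lebesgue_measure \x m.
have E : @lebesgue_rV n.+1 = pushforward lm (@rV_cons R n) by [].
have meas_preimage A : measurable A -> measurable (@rV_cons R n @^-1` A).
  by rewrite -[X in _ -> measurable X]setTI; exact: measurable_rV_cons.
rewrite E; split.
- by rewrite /pushforward preimage_set0 measure0.
- by move=> A; exact: (measure_ge0 lm).
- move=> F mF tF mUF; rewrite /pushforward preimage_bigcup.
  apply: measure_semi_sigma_additive => [k||].
  + exact: meas_preimage.
  + apply/trivIsetP => /= i j _ _ ij; rewrite -preimage_setI.
    by move/trivIsetP : tF => /(_ _ _ _ _ ij) ->//; rewrite preimage_set0.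
  + by rewrite -preimage_bigcup; exact: meas_preimage.
- move=> k; rewrite /pushforward.
  rewrite (_ : _ @^-1` _ = `[(- k%:R)%R, (k%:R)%R]%classic `*`
     [set v : 'rV[R]_n | forall i, (`|v ord0 i| <= k%:R)%R]); last first.
    apply/seteqP; split => -[x v] /=.
      move=> H; split.
        by have := H ord0; rewrite rV_cons0 /= in_itv/= -ler_norml.
      by move=> i; have := H (lift ord0 i); rewrite rV_consS.
    rewrite in_itv/= -ler_norml => -[xk vk] i.
    by case: (unliftP ord0 i) => [j|] ->; rewrite ?rV_consS ?rV_cons0//=.
  rewrite [lm _](product_measure1E lebesgue_measure m)//; last first.
    exact: cube_measurable.
  rewrite lte_mul_pinfty//; last exact: mfin.
  have /= itvE := @lebesgue_measure_itv R `[(- k%:R)%R, k%:R%R].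
  by rewrite [X in X \is a _]itvE; case: ifP.
Qed.

Variable n : nat.

Let lebesgue_rV0 : @lebesgue_rV n set0 = 0.
Proof. by case: (lebesgue_rV_sfm n). Qed.

Let lebesgue_rV_ge0 A : 0 <= @lebesgue_rV n A.
Proof. by case: (lebesgue_rV_sfm n). Qed.

Let lebesgue_rV_sigma_additive : semi_sigma_additive (@lebesgue_rV n).
Proof. by case: (lebesgue_rV_sfm n). Qed.

HB.instance Definition _ := isMeasure.Build _ _ _ (@lebesgue_rV n)
  lebesgue_rV0 lebesgue_rV_ge0 lebesgue_rV_sigma_additive.

HB.instance Definition _ := Measure_isSigmaFinite.Build _ _ _
  (@lebesgue_rV n) (cubes_sigma_finite (lebesgue_rV_sfm n)).

End lebesgue_rV.

Section log_seminorm.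
Context {R : realType}.
Variable d : nat.
Implicit Types (x h : 'rV[R]_d) (f : 'rV[R]_d -> R).

(* The library norm on 'rV[R]_d is the sup norm. *)
Definition eucl_norm x : R := Num.sqrt (\sum_i x ord0 i ^+ 2).

Definition eucl_ball (r : R) : set 'rV[R]_d := [set x | eucl_norm x < r].

Definition log_seminorm (gamma p : R) f : \bar R :=
  ((\int[@lebesgue_rV R d]_(h in eucl_ball (1 / 3))
    \int[@lebesgue_rV R d]_x
      (`|f (x + h) - f x| `^ p / eucl_norm h ^+ d *
       (ln (1 / eucl_norm h) `^ (1 - p * gamma))^-1)%:E) `^ (1 / p))%E.

End log_seminorm.

(* Main.v *)
(** The integral in [x] is the measure of the symmetric difference of [B_r] and
    [B_r - h].  It is at most a constant times [r^d min(1, |h|/r)], because for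
    [|h| < r] the difference lies in the shell [r - |h| <= |x| < r + |h|], and
    it is at least [|B_(r/2)|] once [|h| >= 3r/2].  Cut [B_(1/3)] into the
    shells [rho_(k+1) <= |h| < rho_k] with [rho_k = (3/4)^k / 3].  On the k-th
    one [log(1/|h|)] is comparable to [k+1] and the measure [dh / |h|^d] has a
    mass independent of [k], so with [a = p gamma] and [rho_N] comparable to
    [r] the seminorm is comparable to
    [r^d sum_k min(1, rho_k/r) (k+1)^(a-1)].  The terms [k < N] sum to about
    [N^a], which is about [log(1/r)^a], and the tail decays geometrically.
    The ratio [3/4] (rather than [1/2]) ensures that the lower bound
    [|h| >= 3r/2] holds on at least one full shell for every [r < 1/6]. *)

Require Import Defs.
From mathcomp Require Import all_boot all_order all_algebra.
From mathcomp Require Import all_classical all_reals all_analysis.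
From mathcomp Require Import measurable_realfun.
From mathcomp Require Import ring lra.

Set Implicit Arguments.
Unset Strict Implicit.
Unset Printing Implicit Defensive.

Import Order.TTheory GRing.Theory Num.Theory.
Import numFieldNormedType.Exports.

Local Open Scope classical_set_scope.
Local Open Scope ring_scope.

(** * Monotonicity of nonnegative integrals *)

Section monotone_integral.
Context d (T : measurableType d) (R : realType).
Variable mu : {measure set T -> \bar R}.
Local Open Scope ereal_scope.

(* Unlike [ge0_le_integral], no measurability is required: the integral of a
   nonnegative function is the supremum over the simple functions below it. *)
Lemma ge0_le_integral_any (D : set T) (f g : T -> \bar R) :
  (forall x, D x -> 0 <= f x) -> (forall x, D x -> f x <= g x) ->
  \int[mu]_(x in D) f x <= \int[mu]_(x in D) g x.
Proof.
move=> f0 fg.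
have g0 x : D x -> 0 <= g x by move=> Dx; exact: le_trans (f0 _ Dx) (fg _ Dx).
rewrite !ge0_integralE//; apply: ge_ereal_sup => _ [h /= hf <-].
apply: ereal_sup_ubound; exists h => //= x; apply: le_trans (hf x) _.
exact: lee_restrict.
Qed.

End monotone_integral.

(** * Dilations and cubes under the iterated Lebesgue measure *)

Section lebesgue_rV_theory.
Context {R : realType}.
Local Notation mu1 := (@lebesgue_measure R).

(** Lebesgue measure is determined by its values on half-open intervals, and the pushforward under
    [x |-> t * x], rescaled by [t], has the same values there. *)
Lemma lebesgue_measure_dilation (t : R) (A : set (measurableTypeR R)) :
  0 < t -> measurable A ->
  mu1 A = (t%:E * mu1 ((fun x : measurableTypeR R => t * x)%R @^-1` A))%E.
Proof.
move=> t0 mA.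
pose phi : measurableTypeR R -> measurableTypeR R := fun x => t * x.
have mphi : measurable_fun setT phi by exact: measurable_funM.

pose nu' : {measure set (measurableTypeR R) -> \bar R} := pushforward mu1 phi.
pose nu := nu' mphi.
pose k : {nonneg R} := NngNum (ltW t0).
rewrite -[RHS]/(mscale k nu A).
apply: (lebesgue_measure_unique (mu := mscale k nu)) => // _ [[a b]] _ <-.
rewrite -[RHS]/(t%:E * mu1 (phi @^-1` `]a, b]%classic))%E.
rewrite (_ : _ @^-1` _ = `]a / t, b / t]%classic); last first.
  apply/seteqP; split => x /=; rewrite !in_itv/= ltr_pdivrMr// ler_pdivlMr//;
    by rewrite [x * t]mulrC.
rewrite !lebesgue_measure_itv/= !lte_fin ltr_pM2r ?invr_gt0//.
case: ifPn => _; last by rewrite mule0.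
by rewrite -!EFinB -EFinM -mulrBl mulrC divfK// gt_eqF.
Qed.

Lemma lebesgue_rVS n A :
  @lebesgue_rV R n.+1 A =
  (mu1 \x (@lebesgue_rV R n))%E (@rV_cons R n @^-1` A).
Proof. by []. Qed.

Lemma measurable_rV_cons_preimage n (A : set 'rV[R]_n.+1) :
  measurable A -> measurable (@rV_cons R n @^-1` A).
Proof.
by move=> mA; rewrite -[X in measurable X]setTI; exact: measurable_rV_cons.
Qed.

Lemma measurable_rV_scale n (t : R) :
  measurable_fun setT (fun x : 'rV[R]_n => t *: x).
Proof.
apply/measurable_fun_rVP => i; under eq_fun do rewrite mxE.
by apply: measurable_funM => //; exact: measurable_rV_coord.
Qed.

Lemma scale_rV_cons n (t : R) x :
  t *: @rV_cons R n x = rV_cons (t * x.1, t *: x.2).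
Proof.
apply/rowP => i; rewrite mxE; case: (unliftP ord0 i) => [j|] ->.
  by rewrite !rV_consS mxE.
by rewrite !rV_cons0.
Qed.

(** Induction on the dimension through sections: the one-dimensional dilation rescales the first
    coordinate and gives one factor [t]; the induction hypothesis, applied to each section, gives
    [t ^+ n]. *)
Lemma lebesgue_rV_dilation n (t : R) (A : set 'rV[R]_n) :
  0 < t -> measurable A ->
  lebesgue_rV A = ((t ^+ n)%:E * lebesgue_rV ((fun x => t *: x) @^-1` A))%E.
Proof.
move=> t0; elim: n A => [|n IH] A mA.
  rewrite expr0 mul1e; congr lebesgue_rV; apply/seteqP.
  by split => x /=; rewrite (_ : t *: x = x)//; apply/rowP => -[].
rewrite !lebesgue_rVS.
set B := @rV_cons R n @^-1` A.
have mB : measurable B by exact: measurable_rV_cons_preimage.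
pose g x := @lebesgue_rV R n (xsection B x).
have mg : measurable_fun setT g by exact: measurable_fun_xsection.
have g0 x : (0 <= g x)%E by exact: measure_ge0.
pose phi : measurableTypeR R -> measurableTypeR R := fun x => t * x.
have mphi : measurable_fun setT phi by exact: measurable_funM.

pose nu' : {measure set (measurableTypeR R) -> \bar R} := pushforward mu1 phi.
pose nu := nu' mphi.
pose k : {nonneg R} := NngNum (ltW t0).
have E1 : (\int[mu1]_x g x = t%:E * \int[mu1]_x g (phi x))%E.
  transitivity (\int[mscale k nu]_x g x)%E.
    apply: eq_measure_integral => //= X mX _.
    exact: lebesgue_measure_dilation.
  rewrite ge0_integral_mscale//; congr (_ * _)%E.
  by rewrite ge0_integral_pushforward//= preimage_setT.
rewrite /product_measure1/= -[LHS]/(\int[mu1]_x g x)%E E1 exprS EFinM -muleA.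
congr (_ * _)%E.
rewrite -ge0_integralZl//; last 2 first.
- apply: measurable_fun_xsection.
  apply: measurable_rV_cons_preimage.
  by rewrite -[X in measurable X]setTI; exact: measurable_rV_scale.
- by rewrite lee_fin exprn_ge0// ltW.
apply: eq_integral => x _ /=.
rewrite /g IH; last exact: measurable_xsection.
congr (_ * lebesgue_rV _)%E; apply/seteqP.
by split => y /=; rewrite /xsection/= !inE/= scale_rV_cons.
Qed.

(** Closed cubes have an explicit measure whatever their centre, so a cube around a translated ball
    bounds its measure without appeal to translation invariance. *)
Definition rV_box n (b : 'rV[R]_n) (s : R) : set 'rV[R]_n :=
  [set x | forall i, `|x ord0 i - b ord0 i| <= s].

Lemma measurable_rV_box n (b : 'rV[R]_n) s : measurable (rV_box b s).
Proof.
rewrite (_ : rV_box b s = \bigcap_(i in [set: 'I_n])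
   ((fun x : 'rV[R]_n => x ord0 i : measurableTypeR R) @^-1`
     `[b ord0 i - s, b ord0 i + s]%classic)); last first.
  apply/seteqP; split => v /= vk i.
    by move=> _; rewrite /= in_itv/= -ler_distl.
  by have := vk i Logic.I; rewrite /= in_itv/= -ler_distl.
apply: fin_bigcap_measurable => // i _.
by rewrite -[X in measurable X]setTI; apply: measurable_rV_coord.
Qed.

Lemma lebesgue_rV_box n (b : 'rV[R]_n) (s : R) : 0 <= s ->
  lebesgue_rV (rV_box b s) = ((2 * s) ^+ n)%:E.
Proof.
move=> s0; elim: n b => [|n IH] b.
  by rewrite expr0 /= diracE mem_set//= => -[].
rewrite lebesgue_rVS.
pose b' : 'rV[R]_n := \row_i b ord0 (lift ord0 i).
rewrite (_ : _ @^-1` _ =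
  `[b ord0 ord0 - s, b ord0 ord0 + s]%classic `*` rV_box b' s); last first.
  apply/seteqP; split => -[x v] /=.
    move=> H; split.
      by have := H ord0; rewrite rV_cons0 /= in_itv/= -ler_distl.
    by move=> i; have := H (lift ord0 i); rewrite rV_consS mxE.
  rewrite in_itv/= -ler_distl => -[xk vk] i.
  case: (unliftP ord0 i) => [j|] ->; rewrite ?rV_consS ?rV_cons0//=.
  by have := vk j; rewrite mxE.
transitivity (mu1 `[(b ord0 ord0 - s)%R, (b ord0 ord0 + s)%R]%classic *
    lebesgue_rV (rV_box b' s))%E.
  by rewrite [LHS]product_measure1E//; exact: measurable_rV_box.
rewrite IH lebesgue_measure_itv/= lte_fin.
case: ltP => h; rewrite -?EFinB -EFinM exprS; congr (_ * _)%:E; lra.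
Qed.

End lebesgue_rV_theory.

(** * Euclidean norm and volume of balls *)

Section euclidean_balls.
Context {R : realType}.
Local Notation mu := (@lebesgue_rV R _).

Section norm.
Variable n : nat.
Implicit Types x y : 'rV[R]_n.

Lemma eucl_norm_ge0 x : 0 <= eucl_norm x.
Proof. exact: sqrtr_ge0. Qed.

Lemma sqr_eucl_norm x : eucl_norm x ^+ 2 = \sum_i x ord0 i ^+ 2.
Proof. by rewrite sqr_sqrtr// sumr_ge0// => i _; exact: sqr_ge0. Qed.

Lemma eucl_norm_coord x i : `|x ord0 i| <= eucl_norm x.
Proof.
rewrite -sqrtr_sqr ler_wsqrtr// (bigD1 i)//= lerDl.
by rewrite sumr_ge0// => j _; exact: sqr_ge0.
Qed.

Lemma eucl_normZ t x : eucl_norm (t *: x) = `|t| * eucl_norm x.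
Proof.
rewrite /eucl_norm -sqrtr_sqr -sqrtrM ?sqr_ge0//; congr Num.sqrt.
by rewrite mulr_sumr; apply: eq_bigr => i _; rewrite mxE exprMn.
Qed.

Lemma eucl_normN x : eucl_norm (- x) = eucl_norm x.
Proof. by rewrite -scaleN1r eucl_normZ normrN1 mul1r. Qed.

Lemma eucl_norm_eq0 x : eucl_norm x = 0 -> x = 0.
Proof.
move=> x0; apply/rowP => i; rewrite mxE; apply/eqP.
by rewrite -normr_le0 -x0 eucl_norm_coord.
Qed.

Lemma cauchy_schwarz_rV x y :
  \sum_i x ord0 i * y ord0 i <= eucl_norm x * eucl_norm y.
Proof.
set a := eucl_norm x; set b := eucl_norm y.
have [a0|a0] := leP a 0.
  have -> : x = 0.
    by apply/eucl_norm_eq0/eqP; rewrite eq_le a0 eucl_norm_ge0.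
  by rewrite big1 ?mulr_ge0 ?eucl_norm_ge0// => i _; rewrite mxE mul0r.
have [b0|b0] := leP b 0.
  have -> : y = 0.
    by apply/eucl_norm_eq0/eqP; rewrite eq_le b0 eucl_norm_ge0.
  by rewrite big1 ?mulr_ge0 ?eucl_norm_ge0// => i _; rewrite mxE mulr0.
(* With [a = |x|] and [b = |y|] both positive, expanding this sum of squares gives
   [2ab (ab - C) >= 0], where [C] is the inner product. *)
have : 0 <= \sum_i (b * x ord0 i - a * y ord0 i) ^+ 2.
  by rewrite sumr_ge0// => i _; exact: sqr_ge0.
rewrite (eq_bigr (fun i => b ^+ 2 * x ord0 i ^+ 2 + a ^+ 2 * y ord0 i ^+ 2
   - (2 * a * b) * (x ord0 i * y ord0 i))); last by move=> i _; ring.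
rewrite sumrB big_split/= -!mulr_sumr -!sqr_eucl_norm -/a -/b.
set C := \sum_i _ => H.
have ab0 : 0 < 2 * a * b by rewrite !mulr_gt0.
rewrite -(ler_pM2l ab0).
rewrite -subr_ge0; apply: le_trans H _; rewrite le_eqVlt; apply/orP; left.
by apply/eqP; ring.
Qed.

Lemma ler_eucl_normD x y : eucl_norm (x + y) <= eucl_norm x + eucl_norm y.
Proof.
rewrite -(@ler_pXn2r _ 2) ?nnegrE ?addr_ge0 ?eucl_norm_ge0//.
rewrite sqr_eucl_norm (eq_bigr (fun i => x ord0 i ^+ 2 + y ord0 i ^+ 2
   + 2 * (x ord0 i * y ord0 i))); last by move=> i _; rewrite mxE; ring.
rewrite !big_split/= -mulr_sumr -!sqr_eucl_norm.
have := cauchy_schwarz_rV x y; set C := \sum_i _ => ?.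
rewrite sqrrD; lra.
Qed.

Lemma ler_eucl_normB x y : eucl_norm x - eucl_norm y <= eucl_norm (x + y).
Proof.
rewrite lerBlDr -{1}(addrK y x) (le_trans (ler_eucl_normD _ _))//.
by rewrite eucl_normN.
Qed.

Lemma measurable_eucl_ball r : measurable (@eucl_ball R n r).
Proof.
have [r0|r0] := leP r 0.
  rewrite (_ : eucl_ball r = set0)//; apply/seteqP; split => // x /=.
  by move=> /lt_le_trans => /(_ _ r0); rewrite ltNge eucl_norm_ge0.
pose f (x : 'rV[R]_n) : measurableTypeR R := \sum_i x ord0 i ^+ 2.
have mf : measurable_fun setT f.
  apply: measurable_sum => i.
  exact: (measurable_funX 2 (measurable_rV_coord i)).
rewrite (_ : eucl_ball r = f @^-1` `]-oo, r ^+ 2[%classic); last first.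
  apply/seteqP; split => x /=; rewrite in_itv/= /f -sqr_eucl_norm;
    by rewrite ltr_pXn2r// nnegrE ?eucl_norm_ge0// ltW.
by rewrite -[X in measurable X]setTI; exact: mf.
Qed.

Lemma eucl_ball_sub_box (b : 'rV[R]_n) r :
  [set x | eucl_norm (x - b) < r] `<=` rV_box b r.
Proof.
move=> x /= xr i; rewrite (le_trans _ (ltW xr))//.
by have := eucl_norm_coord (x - b) i; rewrite !mxE.
Qed.

Lemma subset_eucl_ball r s : r <= s -> @eucl_ball R n r `<=` eucl_ball s.
Proof. by move=> rs x /= /lt_le_trans; exact. Qed.

Definition eucl_ball_volume : R := fine (mu (@eucl_ball R n 1)).
Local Notation omega := eucl_ball_volume.

Lemma lebesgue_eucl_ball1 : mu (@eucl_ball R n 1) = omega%:E.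
Proof.
rewrite fineK// ge0_fin_numE; last exact: measure_ge0.
apply: (@le_lt_trans _ _ (mu (rV_box (0 : 'rV[R]_n) 1))).
  apply: le_measure; rewrite ?inE.
  - exact: measurable_eucl_ball.
  - exact: measurable_rV_box.
  - by move=> x x1; apply: eucl_ball_sub_box; rewrite /= subr0.
by rewrite lebesgue_rV_box// ltry.
Qed.

Lemma lebesgue_eucl_ball t : 0 < t ->
  mu (@eucl_ball R n t) = (omega * t ^+ n)%:E.
Proof.
move=> t0; rewrite (lebesgue_rV_dilation t0); last exact: measurable_eucl_ball.
rewrite mulrC EFinM -lebesgue_eucl_ball1; congr (_ * lebesgue_rV _)%E.
apply/seteqP; split => x /=;
  by rewrite /eucl_ball/= eucl_normZ gtr0_norm// gtr_pMr.
Qed.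

Lemma eucl_ball_volume_gt0 : 0 < omega.
Proof.
(* The cube of half-side [1/(n+1)] lies in the unit ball, because [n s^2 <= n s < 1]; using [n+1]
   keeps [s] positive in dimension 0. *)
pose s : R := n.+1%:R^-1.
have s0 : 0 < s by rewrite invr_gt0.
rewrite -lte_fin -lebesgue_eucl_ball1.
apply: (@lt_le_trans _ _ (mu (rV_box (0 : 'rV[R]_n) s))).
  by rewrite lebesgue_rV_box ?ltW// lte_fin exprn_gt0// mulr_gt0.
apply: le_measure; rewrite ?inE.
- exact: measurable_rV_box.
- exact: measurable_eucl_ball.
move=> x /= xs.
have : \sum_i x ord0 i ^+ 2 <= n%:R * s ^+ 2.
  rewrite -[X in X%:R]card_ord -sum1_card natr_sum mulr_suml.
  apply: ler_sum => i _; rewrite mul1r.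
  have := xs i; rewrite mxE subr0 => xis.
  by rewrite -real_normK ?num_real// ler_pXn2r ?nnegrE// ltW.
rewrite -sqr_eucl_norm => H.
rewrite /eucl_ball/= -(@ltr_pXn2r _ 2) ?nnegrE ?eucl_norm_ge0//.
rewrite (le_lt_trans H)//.
have s1 : s <= 1 by rewrite invf_le1// ler1n.
have ns1 : n%:R * s < 1 by rewrite ltr_pdivrMr// mul1r ltr_nat.
rewrite expr1n expr2 mulrA (le_lt_trans _ ns1)// ler_piMr//.
by rewrite mulr_ge0// ltW.
Qed.


End norm.
End euclidean_balls.

(** * Measure of the symmetric difference of a ball and its translate *)

Section difference_of_indicators.
Context {R : realType}.
Local Notation mu := (@lebesgue_rV R _).

(** The difference takes only the values 0, 1 and -1, so the exponent [p] disappears; positivity of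
    [p] matters because [powR] gives 0 to the power 0 the value 1. *)
Lemma norm_indicB_powR (T : Type) (A : set T) (x y : T) (p : R) : 0 < p ->
  `|\1_A y - \1_A x| `^ p = ((y \in A) (+) (x \in A))%:R.
Proof.
move=> p0; rewrite !indicE; case: (y \in A); case: (x \in A) => /=;
  by rewrite ?subrr ?subr0 ?sub0r ?normrN ?normr0 ?normr1 ?powR1 ?powR0 ?gt_eqF.
Qed.

Variable n : nat.
Implicit Types x h : 'rV[R]_n.
Local Notation omega := (@eucl_ball_volume R n).

Definition difference_integral (p r : R) h : \bar R :=
  (\int[mu]_x (`|\1_(eucl_ball r) (x + h) - \1_(eucl_ball r) x| `^ p)%:E)%E.

Lemma difference_integral_le p r h (D : set 'rV[R]_n) : 0 < p ->
  measurable D ->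
  (forall x, (x + h \in eucl_ball r) (+) (x \in eucl_ball r) -> D x) ->
  (difference_integral p r h <= mu D)%E.
Proof.
move=> p0 mD HD; rewrite -(setIT D).
rewrite -(integral_indic mu measurableT mD).
apply: ge0_le_integral_any => x _; first by rewrite lee_fin powR_ge0.
rewrite lee_fin norm_indicB_powR// indicE.
case: (boolP (_ (+) _)) => [/HD Dx|_]; last by rewrite ler0n.
by rewrite mem_set.
Qed.

Lemma difference_integral_ge p r h (D : set 'rV[R]_n) : 0 < p ->
  measurable D ->
  (forall x, D x -> (x + h \in eucl_ball r) (+) (x \in eucl_ball r)) ->
  (mu D <= difference_integral p r h)%E.
Proof.
move=> p0 mD HD; rewrite -(setIT D).
rewrite -(integral_indic mu measurableT mD).
apply: ge0_le_integral_any => x _; first by rewrite lee_fin.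
rewrite lee_fin norm_indicB_powR// indicE.
by case: (boolP (x \in D)) => [/set_mem/HD ->//|_]; exact: ler0n.
Qed.

(** Convexity: on [[0, 1]] the power lies below its chord through the endpoints. *)
Lemma expr_1D_le (u : R) k : 0 <= u <= 1 ->
  (1 + u) ^+ k <= 1 + (2 ^+ k - 1) * u.
Proof.
move=> /andP[u0 u1]; elim: k => [|k IH]; first by rewrite !expr0; lra.
have k1 : 1 <= (2 : R) ^+ k by rewrite exprn_ege1// ler1n.
have := ler_wpM2l (addr_ge0 ler01 u0) IH; rewrite -exprS => /le_trans; apply.
rewrite exprS; set v := 2 ^+ k in k1 *.
have : (v - 1) * u * u <= (v - 1) * u * 1.
  by rewrite ler_wpM2l// mulr_ge0 ?subr_ge0.
nra.
Qed.

(** Bernoulli's inequality. *)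
Lemma expr_1B_ge (u : R) k : 0 <= u <= 1 -> 1 - k%:R * u <= (1 - u) ^+ k.
Proof.
move=> /andP[u0 u1]; elim: k => [|k IH]; first by rewrite expr0; lra.
rewrite exprS; apply: le_trans (ler_wpM2l _ IH); last by rewrite subr_ge0.
rewrite -natr1; have : 0 <= k%:R * u * u by rewrite !mulr_ge0.
nra.
Qed.

(** With [u = s / r], the chord bound and Bernoulli's inequality give the factor [2^k - 1 + k],
    which is at most [2^(k+1)]. This controls the volume of a thin shell. *)
Lemma exprD_exprB_le (r s : R) k : 0 <= s -> s <= r -> 0 < r ->
  (r + s) ^+ k - (r - s) ^+ k <= 2 ^+ k.+1 * r ^+ k * (s / r).
Proof.
move=> s0 sr r0; set u := s / r.
have u01 : 0 <= u <= 1 by rewrite divr_ge0 ?ler_pdivrMr ?mul1r// ltW.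
have -> : r + s = r * (1 + u) by rewrite /u mulrDr mulr1 mulrC divfK ?gt_eqF.
have -> : r - s = r * (1 - u) by rewrite /u mulrBr mulr1 mulrC divfK ?gt_eqF.
rewrite !exprMn -mulrBr [X in _ <= X * _]mulrC -mulrA ler_pM2l ?exprn_gt0//.
have := expr_1D_le k u01; have := expr_1B_ge k u01.
have : k%:R <= (2 : R) ^+ k by rewrite -natrX ler_nat ltnW// ltn_expl.
rewrite exprS; case/andP: u01; nra.
Qed.

(** The first two terms serve [|h| >= r] (a ball and a cube of side [2r]); the last one serves
    [|h| < r] (the volume of a thin shell). *)
Definition difference_const : R := omega + 2 ^+ n + omega * 2 ^+ n.+1.

Lemma difference_const_gt0 : 0 < difference_const.
Proof.
have := @eucl_ball_volume_gt0 R n => ?.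
by rewrite !addr_gt0 ?mulr_gt0 ?exprn_gt0.
Qed.

Lemma difference_integral_le_min p r h : 0 < p -> 0 < r ->
  (difference_integral p r h <=
   (difference_const * r ^+ n * Num.min 1 (eucl_norm h / r))%:E)%E.
Proof.
move=> p0 r0; have w0 := @eucl_ball_volume_gt0 R n.
have rn0 : 0 < r ^+ n by rewrite exprn_gt0.
have h0 := eucl_norm_ge0 h.
have [hr|rh] := ltP (eucl_norm h) r; last first.
  have -> : Num.min 1 (eucl_norm h / r) = 1.
    by apply/min_idPl; rewrite ler_pdivlMr// mul1r.
  (* The translate of the ball by [-h] is enclosed in a cube centred at [-h]. *)
  pose D := @eucl_ball R n r `|` rV_box (- h) r.
  have mD : measurable D.
    apply: measurableU; first exact: measurable_eucl_ball.
    exact: measurable_rV_box.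
  apply: (@le_trans _ _ (mu D)).
    apply: difference_integral_le => // x.
    have [/set_mem xB|_] := boolP (x \in eucl_ball r); first by left.
    rewrite addbF => /set_mem xhB; right; apply: eucl_ball_sub_box.
    by rewrite /= opprK.
  apply: le_trans (measureU2 _ _ _) _; rewrite /=;
    [exact: measurable_eucl_ball|exact: measurable_rV_box|].
  rewrite lebesgue_eucl_ball// lebesgue_rV_box; last exact: ltW.
  rewrite -EFinD lee_fin exprMn.
  rewrite mulr1 -mulrDl ler_pM2r// /difference_const lerDl.
  by rewrite mulr_ge0 ?exprn_ge0// ltW.
have -> : Num.min 1 (eucl_norm h / r) = eucl_norm h / r.
  by apply/min_idPr; rewrite ler_pdivrMr// mul1r ltW.
pose D := @eucl_ball R n (r + eucl_norm h) `\` eucl_ball (r - eucl_norm h).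
have mD : measurable D by apply: measurableD; exact: measurable_eucl_ball.
apply: (@le_trans _ _ (mu D)).
  apply: difference_integral_le => // x.
  have tx := ler_eucl_normB x h; have tx' := ler_eucl_normB (x + h) (- h).
  have tx2 := ler_eucl_normD x h.
  rewrite addrK eucl_normN in tx'.
  have [/set_mem/= xB|/negP xB] := boolP (x \in eucl_ball r).
    rewrite addbT => /negP xhB; split.
      by move: xB; rewrite /eucl_ball/=; lra.
    rewrite /eucl_ball/= => xb; apply: xhB; apply/mem_set.
    by rewrite /eucl_ball/=; lra.
  rewrite addbF => /set_mem/= xhB; split.
    by move: xhB; rewrite /eucl_ball/=; lra.
  rewrite /eucl_ball/= => xb; apply: xB; apply/mem_set.
  by rewrite /eucl_ball/=; lra.
rewrite [X in (X <= _)%E]measureD; last first.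
- by rewrite [X in (X < _)%E]lebesgue_eucl_ball ?ltry// ltr_wpDr.
- exact: measurable_eucl_ball.
- exact: measurable_eucl_ball.
rewrite setIidr; last by apply: subset_eucl_ball; lra.
rewrite [X in (X - _)%E]lebesgue_eucl_ball ?ltr_wpDr//.
rewrite [X in (_ - X)%E]lebesgue_eucl_ball ?subr_gt0// -EFinB lee_fin -mulrBr.
have u0 : 0 <= eucl_norm h / r by rewrite divr_ge0// ltW.
apply: (@le_trans _ _ (omega * (2 ^+ n.+1 * r ^+ n * (eucl_norm h / r)))).
  by rewrite ler_pM2l// exprD_exprB_le// ltW.
have E : omega * 2 ^+ n.+1 <= difference_const.
  by rewrite lerDr addr_ge0 ?exprn_ge0// ltW.
rewrite [leLHS](_ : _ = omega * 2 ^+ n.+1 * r ^+ n * (eucl_norm h / r)).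
  by rewrite ler_wpM2r// ler_wpM2r// ltW.
by rewrite !mulrA.
Qed.

(** If [|x| < r/2], then [|x + h| >= |h| - |x| > r], so all of [B_(r/2)] lies in the symmetric
    difference. *)
Lemma difference_integral_ge_ball p r h : 0 < p -> 0 < r ->
  3 / 2 * r <= eucl_norm h ->
  ((omega * (r / 2) ^+ n)%:E <= difference_integral p r h)%E.
Proof.
move=> p0 r0 rh; rewrite -lebesgue_eucl_ball ?divr_gt0//.
apply: difference_integral_ge => //; first exact: measurable_eucl_ball.
move=> x /= xr; rewrite [X in _ (+) X]mem_set ?addbT; last first.
  by rewrite /eucl_ball/=; move: xr; rewrite /eucl_ball/=; lra.
apply/negP => /set_mem/=; rewrite /eucl_ball/=.
have := ler_eucl_normB h x; rewrite [h + x]addrC.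
move: xr; rewrite /eucl_ball/=; lra.
Qed.

End difference_of_indicators.

(** * Power sums and geometrically damped power sums *)

Section power_sums.
Context {R : realType}.
Implicit Types (a e u v x y : R).

(** Young's inequality for the product of [u^e] and 1, with conjugate exponents [1/e] and
    [1/(1-e)]. *)
Lemma powR_le_tangent e u : 0 < e -> e <= 1 -> 0 <= u ->
  u `^ e <= e * u + (1 - e).
Proof.
move=> e0; rewrite le_eqVlt => /predU1P[-> u0|e1 u0].
  by rewrite powRr1// mul1r subrr addr0.
have e1' : 0 < (1 - e) by rewrite subr_gt0.
have := @conjugate_powR R (u `^ e) 1 e^-1 (1 - e)^-1 (powR_ge0 _ _) ler01.
rewrite !invr_gt0 !invrK => /(_ e0 e1'); rewrite subrKC => /(_ erefl).
by rewrite mulr1 -powRrM mulfV ?gt_eqF// powRr1// powR1 mul1r mulrC.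
Qed.

(** This and the next lemma replace the mean value theorem for [t^a]. For [a <= 1] the tangent bound
    applies; for [a > 1], simply [u^a <= u]. *)
Lemma onem_powR_ge a u : 0 < a -> 0 <= u <= 1 ->
  1 - u <= (1 + a^-1) * (1 - u `^ a).
Proof.
move=> a0 /andP[u0 u1]; have ia0 : 0 < a^-1 by rewrite invr_gt0.
have [a1|a1] := leP a 1.
  have := powR_le_tangent a0 a1 u0.
  set w := u `^ a => H.
  have H' : a * (1 - u) <= 1 - w by lra.
  have w1 : 0 <= 1 - w by apply: le_trans H'; rewrite mulr_ge0 ?subr_ge0// ltW.
  have := ler_wpM2l (ltW ia0) H'; rewrite mulrA mulVf ?gt_eqF//; lra.
have : u `^ a <= u.
  move: u0; rewrite le_eqVlt => /predU1P[<-|u0]; first by rewrite powR0 ?gt_eqF.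
  by apply: ge1r_powR; rewrite ?u0// ltW.
set w := u `^ a => H.
have : 0 <= a^-1 * (1 - w) by apply: mulr_ge0; [exact: ltW|lra].
lra.
Qed.

Lemma onem_powR_le a u : 0 < a -> 0 <= u <= 1 ->
  1 - u `^ a <= (1 + a) * (1 - u).
Proof.
move=> a0 /andP[u0 u1].
have [a1|a1] := leP a 1.
  have : u <= u `^ a.
    move: u0; rewrite le_eqVlt => /predU1P[<-|u0]; first by rewrite powR_ge0.
    by apply: ger1_powR; rewrite ?u0.
  set w := u `^ a => H.
  have : 0 <= a * (1 - u) by apply: mulr_ge0; [exact: ltW|lra].
  lra.
have ia0 : 0 < a^-1 by rewrite invr_gt0.
have ia1 : a^-1 <= 1 by rewrite invf_le1// ltW.
(* The tangent bound with exponent [1/a] at the point [u^a] bounds [u] itself. *)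
have := powR_le_tangent ia0 ia1 (powR_ge0 u a).
rewrite -powRrM mulfV ?gt_eqF// powRr1//; set w := u `^ a => H.
have := ler_wpM2l (ltW a0) H.
rewrite mulrDr mulrA mulfV ?gt_eqF// mulrBr mulfV ?gt_eqF//.
nra.
Qed.

Lemma powR_succ_diff a x : 0 < a -> 0 <= x ->
  (x + 1) `^ a - x `^ a =
  (x + 1) `^ (a - 1) * ((x + 1) * (1 - (x / (x + 1)) `^ a)).
Proof.
move=> a0 x0; have y0 : 0 < x + 1 by lra.
have E : x `^ a = (x / (x + 1)) `^ a * (x + 1) `^ a.
  by rewrite -powRM ?divr_ge0// ?divfK ?gt_eqF// ltW.
by rewrite {1}E -(mulr_powRB1 (ltW y0) a0); ring.
Qed.

(** Telescoping: each term is comparable to [(k+1)^a - k^a]. With [u = k/(k+1)] this increment is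
    [(k+1)^(a-1)] times [(k+1)(1 - u^a)], and the latter is comparable to [(k+1)(1 - u) = 1]. *)
Lemma powR_sum_bounds a (K : nat) : 0 < a ->
  K%:R `^ a <= (1 + a) * \sum_(k < K) k.+1%:R `^ (a - 1) /\
  \sum_(k < K) k.+1%:R `^ (a - 1) <= (1 + a^-1) * K%:R `^ a.
Proof.
move=> a0; elim: K => [|K [IH1 IH2]].
  by rewrite big_ord0 powR0 ?gt_eqF// !mulr0 lexx.
rewrite big_ord_recr/=; set S := \sum_(k < K) _ in IH1 IH2 *.
have x0 : 0 <= K%:R :> R by [].
have y0 : 0 < K%:R + 1 :> R by lra.
have := powR_succ_diff a0 x0.
rewrite natr1; set u := K%:R / K.+1%:R => E.
have u01 : 0 <= u <= 1.
  by rewrite /u divr_ge0//= ler_pdivrMr// mul1r ler_nat.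
have yu : K.+1%:R * (1 - u) = 1.
  by rewrite mulrBr mulr1 /u mulrC divfK// -natr1 addrC addKr.
have w0 := powR_ge0 (K.+1%:R : R) (a - 1).
have H1 := onem_powR_ge a0 u01.
have H2 := onem_powR_le a0 u01.
have p0 : 0 < K.+1%:R :> R by [].
have H1' := ler_wpM2l (ltW p0) H1; rewrite yu in H1'.
have H2' := ler_wpM2l (ltW p0) H2; rewrite [X in _ <= X]mulrCA yu mulr1 in H2'.
have G1 := ler_wpM2l w0 H1'; have G2 := ler_wpM2l w0 H2'.
rewrite -E in G2; rewrite mulr1 mulrCA mulrCA [X in _ <= X]mulrCA in G1.
have G1' : K.+1%:R `^ (a - 1) <= (1 + a^-1) * (K.+1%:R `^ a - K%:R `^ a).
  rewrite E; apply: le_trans G1 _.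
  by rewrite le_eqVlt; apply/orP; left; apply/eqP; ring.
split; lra.
Qed.

(** Raise [b y <= exp(b y)] to the power [a]. The rate [b] is free, so a power can be absorbed by an
    arbitrarily slow exponential. *)
Lemma powR_le_expR a b y : 0 < a -> 0 < b -> 0 <= y ->
  y `^ a <= b^-1 `^ a * expR (a * b * y).
Proof.
move=> a0 b0 y0.
have by0 : 0 <= b * y by rewrite mulr_ge0// ltW.
have -> : y `^ a = b^-1 `^ a * (b * y) `^ a.
  by rewrite -powRM ?invr_ge0 ?(ltW b0)// mulKf ?gt_eqF.
rewrite ler_wpM2l ?powR_ge0// -mulrA [a * _]mulrC expRM.
apply: ge0_ler_powR; rewrite ?nnegrE ?expR_ge0 ?(ltW a0)//.
by apply: le_trans (expR_ge1Dx _); rewrite lerDr.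
Qed.

Lemma sum_geometric_le (q : R) (K : nat) : 0 <= q < 1 ->
  \sum_(k < K) q ^+ k <= (1 - q)^-1.
Proof.
move=> /andP[q0 q1]; rewrite -[leRHS]mul1r ler_pdivlMr ?subr_gt0//.
have -> : (\sum_(k < K) q ^+ k) * (1 - q) = 1 - q ^+ K.
  by rewrite -opprB mulrN mulrC -subrX1 opprB.
by rewrite lerBlDr lerDl exprn_ge0.
Qed.

Lemma geometric_powR_sum_bounded a : 0 < a ->
  exists2 M, 0 < M & forall K : nat,
    \sum_(j < K) (3 / 4) ^+ j * j.+2%:R `^ a <= M.
Proof.
move=> a0.
(* [g] is the square root of 4/3: half of the decay of [(3/4)^j] absorbs the power, and the ratio
   [q], the square root of 3/4, remains. *)
pose g : R := expR (ln (4 / 3) / 2).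
have gg : g * g = 4 / 3.
  by rewrite -expRD -splitr lnK// posrE; lra.
have g0 : 0 < g by exact: expR_gt0.
pose q := 3 / 4 * g.
have q01 : 0 <= q < 1.
  apply/andP; split; first by rewrite mulr_ge0 ?(ltW g0)//; lra.
  rewrite /q; have : g < 4 / 3; last by lra.
  rewrite ltNge; apply/negP => h; have : 4 / 3 * (4 / 3) <= g * g; last by lra.
  by apply: ler_pM => //; lra.
have l0 : 0 < ln (4 / 3 : R) by rewrite ln_gt0//; lra.
(* Chosen so that [exp(a b y) = g^y]; the factor [g * g] in [B] pays for the shift from [j] to
   [j+2]. *)
pose b := ln (4 / 3) / 2 / a.
have b0 : 0 < b by rewrite !divr_gt0.
pose B := b^-1 `^ a * (g * g).
have B0 : 0 < B by rewrite !mulr_gt0// powR_gt0// invr_gt0.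
have termE (j : nat) : (3 / 4) ^+ j * j.+2%:R `^ a <= B * q ^+ j.
  have := @powR_le_expR a b j.+2%:R a0 b0 (ler0n _ _).
  have -> : a * b * j.+2%:R = j.+2%:R * (ln (4 / 3) / 2).
    by rewrite mulrC /b [a * _]mulrC divfK ?gt_eqF.
  rewrite expRM_natl -/g => H.
  have := ler_wpM2l (exprn_ge0 j (ltW (_ : 0 < 3 / 4 :> R))) H.
  move=> /(_ ltac:(lra)) /le_trans; apply.
  rewrite /B /q [(3 / 4 * g) ^+ j]exprMn 2!exprS.
  move: ((3 / 4) ^+ j) (g ^+ j) (b^-1 `^ a) => s t P.
  by rewrite le_eqVlt; apply/orP; left; apply/eqP; ring.
exists (B * (1 - q)^-1) => [|K].
  by rewrite mulr_gt0// invr_gt0 subr_gt0; case/andP: q01.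
apply: (@le_trans _ _ (\sum_(j < K) B * q ^+ j)); first exact: ler_sum.
by rewrite -mulr_sumr ler_pM2l// sum_geometric_le.
Qed.

(** Which of the two endpoints gives the bound depends on the sign of [e]; the sum of both constants
    covers both signs. *)
Lemma powR_comparable_le e (al be u v : R) : 0 < al -> 0 < v ->
  al * v <= u -> u <= be * v ->
  u `^ e <= (al `^ e + be `^ e) * v `^ e.
Proof.
move=> al0 v0 alu ube.
have av0 : 0 < al * v by rewrite mulr_gt0.
have u0 : 0 < u by exact: lt_le_trans alu.
have be0 : 0 < be by rewrite -(pmulr_lgt0 _ v0); exact: lt_le_trans ube.
rewrite mulrDl -!powRM ?(ltW al0) ?(ltW be0) ?(ltW v0)//.
have [e0|e0] := leP 0 e.
  apply: ler_wpDl; first exact: powR_ge0.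
  by apply: ge0_ler_powR; rewrite ?nnegrE ?(ltW u0)// mulr_ge0// ltW.
apply: ler_wpDr; first exact: powR_ge0.
have -> : e = - - e by rewrite opprK.
rewrite ![_ `^ (- - e)]powRN lef_pV2 ?posrE ?powR_gt0//.
apply: ge0_ler_powR => //; rewrite ?nnegrE ?oppr_ge0.
- exact: ltW.
- exact: ltW.
- exact: ltW.
Qed.

Lemma powR_comparable_ge e (al be u v : R) : 0 < al -> 0 < v ->
  al * v <= u -> u <= be * v ->
  (al `^ (- e) + be `^ (- e))^-1 * v `^ e <= u `^ e.
Proof.
move=> al0 v0 alu ube.
have u0 : 0 < u by apply: lt_le_trans alu; rewrite mulr_gt0.
have s0 : 0 < al `^ (- e) + be `^ (- e) by rewrite ltr_pwDl ?powR_gt0 ?powR_ge0.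
have := powR_comparable_le (- e) al0 v0 alu ube.
set s := _ + _ in s0 * => H.
rewrite ler_pdivrMl//; move: H; rewrite !powRN.
by rewrite ler_pdivlMr ?powR_gt0// mulrC ler_pdivrMr ?powR_gt0.
Qed.

(** Here [theta k] models [min(1, rho_k / r)] and [N] the shell at scale [r]. The first [N] terms
    form a power sum. In the tail, [N + j + 1 <= N (j + 2)] extracts [N^a] and leaves a convergent
    damped sum. *)
Lemma damped_powR_sum_le a : 0 < a ->
  exists2 C, 0 < C & forall (N : nat) (theta : nat -> R), (0 < N)%N ->
    (forall k, 0 <= theta k <= 1) ->
    (forall j, theta (N + j)%N <= 2 * (3 / 4) ^+ j) ->
    forall K : nat,
      \sum_(k < K) theta k * k.+1%:R `^ (a - 1) <= C * N%:R `^ a.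
Proof.
move=> a0; have [M M0 HM] := geometric_powR_sum_bounded a0.
exists (1 + a^-1 + 2 * M) => [|N th N0 th01 thN K].
  by rewrite !addr_gt0 ?mulr_gt0// invr_gt0.
have t0 k : 0 <= th k * k.+1%:R `^ (a - 1).
  by rewrite mulr_ge0 ?powR_ge0//; case/andP: (th01 k).
(* Padding to [N + K] terms lets the sum be split at [N] whether or not [K] exceeds [N]. *)
apply: (@le_trans _ _ (\sum_(k < N + K) th k * k.+1%:R `^ (a - 1))).
  rewrite [leRHS](_ : _ = \sum_(k < K + N) th k * k.+1%:R `^ (a - 1));
    last by rewrite addnC.
  by rewrite big_split_ord/= lerDl sumr_ge0.
rewrite big_split_ord/= mulrDl; apply: lerD.
  have [_ H] := powR_sum_bounds N a0.
  apply: le_trans H; apply: ler_sum => k _.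
  by rewrite ler_piMl ?powR_ge0//; case/andP: (th01 k).
apply: (@le_trans _ _
    (2 * N%:R `^ a * \sum_(j < K) (3 / 4) ^+ j * j.+2%:R `^ a)); last first.
  by rewrite [leRHS]mulrAC ler_pM2l// mulr_gt0// powR_gt0// ltr0n.
rewrite mulr_sumr.
apply: ler_sum => j _.
apply: (@le_trans _ _ (2 * (3 / 4) ^+ j * (N%:R * j.+2%:R) `^ a)); last first.
  by rewrite powRM// le_eqVlt; apply/orP; left; apply/eqP; ring.
have th_ge0 : 0 <= th (N + j)%N by case/andP: (th01 (N + j)%N).
apply: ler_pM; rewrite ?powR_ge0 ?thN//.
apply: (@le_trans _ _ ((N + j).+1%:R `^ a)).
  by apply: ler_powR; rewrite ?ler1n//; lra.
apply: ge0_ler_powR; rewrite ?nnegrE ?mulr_ge0 ?(ltW a0)//.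
rewrite -natrM ler_nat.
by rewrite !mulnS -addnS leq_add2l -add1n leq_add// leq_pmull.
Qed.

End power_sums.

(** * Decomposition of the ball of radius 1/3 into geometric shells *)

Section shells.
Context {R : realType}.
Local Notation mu := (@lebesgue_rV R _).

Definition shell_radius (k : nat) : R := 3^-1 * (3 / 4) ^+ k.
Local Notation rho := shell_radius.

Lemma shell_radius_gt0 k : 0 < rho k.
Proof. by rewrite mulr_gt0 ?invr_gt0// exprn_gt0//; lra. Qed.

Lemma shell_radiusS k : rho k.+1 = 3 / 4 * rho k.
Proof. by rewrite /shell_radius exprS; ring. Qed.

Lemma shell_radiusD k j : rho (k + j) = rho k * (3 / 4) ^+ j.
Proof. by rewrite /shell_radius exprD mulrA. Qed.

Lemma shell_radius_le k j : (k <= j)%N -> rho j <= rho k.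
Proof.
move=> kj; rewrite ler_pM2l ?invr_gt0//; apply: ler_wiXn2l => //; lra.
Qed.

Lemma ln_inv_shell_radius k : ln (1 / rho k) = ln 3 + k%:R * ln (4 / 3).
Proof.
have e : 1 / rho k = 3 * (4 / 3) ^+ k.
  rewrite /shell_radius div1r invfM invrK -exprVn; congr (_ * _ ^+ _).
  by rewrite invf_div.
have q0 : 0 < 4 / 3 :> R by lra.
have t0 : 0 < 3 :> R by lra.
rewrite e lnM ?posrE ?exprn_gt0// lnXn//; congr (_ + _).
by rewrite [RHS]mulr_natl.
Qed.

Lemma shell_radius_bracket (s : R) : 0 < s -> s < 3^-1 ->
  exists k, rho k.+1 <= s < rho k.
Proof.
move=> s0 s3.
have ex : exists k, rho k <= s.
  have q1 : `|3 / 4 : R| < 1 by rewrite ger0_norm; lra.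
  have s30 : 0 < 3 * s by rewrite mulr_gt0.
  have /cvgrPdist_lt/(_ _ s30)[k _ /(_ k (leqnn k))] := cvg_expr q1.
  rewrite sub0r normrN ger0_norm ?exprn_ge0// => /ltW H; exists k.
  by rewrite /shell_radius ler_pdivrMl.
(* The least index with [rho k <= s] is positive because [rho 0 = 1/3 > s]; its predecessor is the
   required shell. *)
case: (ex_minnP ex) => -[|k] rk kmin.
  by move: rk; rewrite /shell_radius expr0 mulr1 leNgt s3.
exists k; rewrite rk/= ltNge; apply/negP => /kmin.
by rewrite ltnn.
Qed.

Variable n : nat.
Implicit Types h : 'rV[R]_n.
Local Notation omega := (@eucl_ball_volume R n).

Definition shell (k : nat) : set 'rV[R]_n :=
  eucl_ball (rho k) `\` eucl_ball (rho k.+1).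

Lemma shellP k h : shell k h <-> rho k.+1 <= eucl_norm h < rho k.
Proof.
split=> [[hk /negP]|/andP[h1 h2]]; first by rewrite -leNgt => ->.
by split => //; apply/negP; rewrite -leNgt.
Qed.

Lemma measurable_shell k : measurable (shell k).
Proof. by apply: measurableD; exact: measurable_eucl_ball. Qed.

Lemma shell_sub_ball k : shell k `<=` eucl_ball (1 / 3).
Proof.
move=> h [hk _]; apply: subset_eucl_ball hk.
have := shell_radius_le (leq0n k).
by rewrite [X in _ <= X]/shell_radius expr0 mulr1 div1r.
Qed.

Lemma shell_inj k j h : shell k h -> shell j h -> k = j.
Proof.
move=> /shellP/andP[k1 k2] /shellP/andP[j1 j2].
have [/shell_radius_le|/shell_radius_le|//] := ltngtP k j.
  by rewrite leNgt (le_lt_trans k1 j2).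
by rewrite leNgt (le_lt_trans j1 k2).
Qed.

Lemma lebesgue_shell k :
  mu (shell k) = (omega * (1 - (3 / 4) ^+ n) * rho k ^+ n)%:E.
Proof.
have rk := shell_radius_gt0 k; have rk1 := shell_radius_gt0 k.+1.
rewrite [LHS]measureD; last first.
- by rewrite [X in (X < _)%E]lebesgue_eucl_ball ?ltry.
- exact: measurable_eucl_ball.
- exact: measurable_eucl_ball.
rewrite setIidr; last exact/subset_eucl_ball/shell_radius_le.
rewrite [X in (X - _)%E]lebesgue_eucl_ball//.
rewrite [X in (_ - X)%E]lebesgue_eucl_ball// -EFinB; congr _%:E.
by rewrite shell_radiusS [(3 / 4 * _) ^+ n]exprMn; ring.
Qed.

Let integral_shell k (c : R) : 0 <= c ->
  (\int[mu]_(h in @eucl_ball R n (1 / 3)) (c * \1_(shell k) h)%:E =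
   (c * (omega * (1 - (3 / 4) ^+ n) * rho k ^+ n))%:E)%E.
Proof.
move=> c0; under eq_integral do rewrite EFinM.
rewrite ge0_integralZl_EFin//; last 2 first.
- exact: measurable_eucl_ball.
- by apply/measurable_EFinP/measurable_indic; exact: measurable_shell.
rewrite integral_indic; [|exact: measurable_eucl_ball|exact: measurable_shell].
rewrite setIidl; last exact: shell_sub_ball.
by rewrite EFinM -lebesgue_shell.
Qed.

Let measurable_shell_step (D : set 'rV[R]_n) k (c : R) :
  measurable_fun D (fun h => (c * \1_(shell k) h)%:E).
Proof.
apply/measurable_EFinP/measurable_funM => //.
by apply: measurable_indic; exact: measurable_shell.
Qed.

(** [F] is dominated by a step function, a countable sum over the shells, which is integrated term
    by term. The origin belongs to no shell; there [F 0 = 0] gives the bound. *)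
Lemma integral_ball_le_shells (F : 'rV[R]_n -> \bar R) (c : nat -> R) (C : R) :
  (forall h, 0 <= F h)%E -> F 0 = 0%E -> (forall k, 0 <= c k) ->
  (forall k h, shell k h -> F h <= (c k)%:E)%E ->
  (forall K : nat,
     \sum_(k < K) c k * (omega * (1 - (3 / 4) ^+ n) * rho k ^+ n) <= C) ->
  (\int[mu]_(h in eucl_ball (1 / 3)) F h <= C%:E)%E.
Proof.
move=> F0 F00 c0 Fc HC.
pose f k h : \bar R := (c k * \1_(shell k) h)%:E.
have f0 k h : (0 <= f k h)%E by rewrite lee_fin mulr_ge0.
apply: (@le_trans _ _
    (\int[mu]_(h in @eucl_ball R n (1 / 3)) \sum_(k <oo) f k h)%E).
  apply: ge0_le_integral_any => // h hB.
  have [h0|h0] := leP (eucl_norm h) 0.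
    have -> : h = 0.
      by apply/eucl_norm_eq0/eqP; rewrite eq_le h0 eucl_norm_ge0.
    by rewrite F00 nneseries_ge0.
  have h3 : eucl_norm h < 3^-1 by move: hB; rewrite /eucl_ball/= div1r.
  have [k /shellP hk] := shell_radius_bracket h0 h3.
  apply: le_trans (Fc _ _ hk) _.
  have := @nneseries_lim_ge R (fun k => f k h) xpredT 0%N k.+1.
  move=> /(_ (fun i _ _ => f0 i h)); apply: le_trans.
  rewrite big_mkord big_ord_recr/= {2}/f indicE mem_set// mulr1.
  by rewrite leeDr// sume_ge0.
rewrite integral_nneseries; last 3 first.
- exact: measurable_eucl_ball.
- by move=> k; exact: measurable_shell_step.
- by move=> k h _; exact: f0.
under eq_eseriesr do rewrite integral_shell//.
apply: lime_le.
  apply: is_cvg_nneseries => k _ _; rewrite -integral_shell//.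
  by apply: integral_ge0 => h _; exact: f0.
near=> K; rewrite big_mkord sumEFin lee_fin; exact: HC.
Unshelve. all: by end_near. Qed.

(** The shells are disjoint, so at each point at most one term of the step function is nonzero, and
    it lies below [F]. *)
Lemma integral_ball_ge_shells (F : 'rV[R]_n -> \bar R) (c : nat -> R)
    (K : nat) :
  (forall h, 0 <= F h)%E -> (forall k, 0 <= c k) ->
  (forall k h, (k < K)%N -> shell k h -> (c k)%:E <= F h)%E ->
  ((\sum_(k < K) c k * (omega * (1 - (3 / 4) ^+ n) * rho k ^+ n))%:E <=
   \int[mu]_(h in eucl_ball (1 / 3)) F h)%E.
Proof.
move=> F0 c0 Fc.
pose f k h : \bar R := (c k * \1_(shell k) h)%:E.
have f0 k h : (0 <= f k h)%E by rewrite lee_fin mulr_ge0.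
rewrite -sumEFin; under eq_bigr do rewrite -integral_shell//.
rewrite -(ge0_integral_sum mu _ (f := fun (k : 'I_K) h => f k h)); last 3 first.
- exact: measurable_eucl_ball.
- by move=> k; exact: measurable_shell_step.
- by move=> k h _; exact: f0.
apply: ge0_le_integral_any => h hB; first by rewrite sume_ge0.
have [[k hk]|nok] := pselect (exists k : 'I_K, shell k h); last first.
  rewrite big1// => k _; rewrite /f indicE memNset ?mulr0//.
  by move=> hk; apply: nok; exists k.
rewrite (bigD1 k)//= big1 ?adde0; last first.
  move=> j jk; rewrite /f indicE memNset ?mulr0// => hj.
  by move: jk; rewrite -val_eqE/= (shell_inj hj hk) eqxx.
by rewrite /f indicE mem_set// mulr1; exact: Fc.
Qed.

End shells.

(** * The logarithmic weight on each shell *)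

Section logarithmic_weight.
Context {R : realType}.
Local Notation mu := (@lebesgue_rV R _).
Local Notation rho := (@shell_radius R).
Variable n : nat.
Implicit Types h : 'rV[R]_n.

Definition log_weight (a s : R) : R := ln (1 / s) `^ (a - 1).

Let ln43_gt0 : 0 < ln (4 / 3 : R).
Proof. by rewrite ln_gt0//; lra. Qed.

Let ln43_le_ln3 : ln (4 / 3 : R) <= ln 3.
Proof. by rewrite ler_ln ?posrE//; lra. Qed.

(** The lower bound trades [ln 3] for one more [ln (4/3)], which turns [k] into [k+1] and stays
    positive on the outermost shell. *)
Lemma ln_inv_bounds (s : R) k : rho k.+1 <= s <= rho k ->
  k.+1%:R * ln (4 / 3) <= ln (1 / s) /\
  ln (1 / s) <= ln 3 + k.+1%:R * ln (4 / 3).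
Proof.
move=> /andP[s1 s2].
have s0 : 0 < s by apply: lt_le_trans s1; exact: shell_radius_gt0.
rewrite -!ln_inv_shell_radius; split; last first.
  rewrite ler_ln ?posrE ?divr_gt0 ?shell_radius_gt0//.
  by rewrite !div1r lef_pV2 ?posrE ?shell_radius_gt0.
apply: (@le_trans _ _ (ln (1 / rho k))); last first.
  rewrite ler_ln ?posrE ?divr_gt0 ?shell_radius_gt0//.
  by rewrite !div1r lef_pV2 ?posrE ?shell_radius_gt0.
by rewrite ln_inv_shell_radius -[k.+1%:R]natr1 mulrDl mul1r addrC lerD2r.
Qed.

(** This constant and the next come from comparing [ln (1 / s)] with [k+1], with ratio between
    [ln (4/3)] and [ln 3 + ln (4/3)]. *)
Definition weight_upper (a : R) : R :=
  ln (4 / 3) `^ (a - 1) + (ln 3 + ln (4 / 3)) `^ (a - 1).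

Definition weight_lower (a : R) : R :=
  (ln (4 / 3) `^ (- (a - 1)) + (ln 3 + ln (4 / 3)) `^ (- (a - 1)))^-1.

Lemma weight_upper_gt0 a : 0 < weight_upper a.
Proof. by rewrite ltr_pwDl ?powR_gt0 ?powR_ge0. Qed.

Lemma weight_lower_gt0 a : 0 < weight_lower a.
Proof. by rewrite invr_gt0 ltr_pwDl ?powR_gt0 ?powR_ge0. Qed.

Lemma log_weight_bounds a s k : rho k.+1 <= s <= rho k ->
  weight_lower a * k.+1%:R `^ (a - 1) <= log_weight a s /\
  log_weight a s <= weight_upper a * k.+1%:R `^ (a - 1).
Proof.
move=> sk; have [H1 H2] := ln_inv_bounds sk.
have H2' : ln (1 / s) <= (ln 3 + ln (4 / 3)) * k.+1%:R.
  apply: le_trans H2 _.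
  rewrite [leRHS]mulrDl [X in _ <= _ + X]mulrC lerD2r ler_peMr ?ler1n//.
  by apply: le_trans ln43_le_ln3; exact: ltW.
rewrite mulrC in H1; have k0 : 0 < k.+1%:R :> R by [].
by split; [exact: powR_comparable_ge H1 H2'|exact: powR_comparable_le H1 H2'].
Qed.

Lemma measurable_indic_ball_difference (p r : R) h :
  measurable_fun setT (fun x : 'rV[R]_n =>
    (`|\1_(eucl_ball r) (x + h) - \1_(eucl_ball r) x| `^ p)%:E).
Proof.
have mB : measurable (@eucl_ball R n r) by exact: measurable_eucl_ball.
have mt : measurable_fun setT (fun x : 'rV[R]_n => x + h).
  apply/measurable_fun_rVP => i; under eq_fun do rewrite mxE.
  by apply: measurable_funD => //; exact: measurable_rV_coord.
apply/measurable_EFinP; apply: (measurableT_comp (measurable_powR p)).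
apply: measurableT_comp => //; apply: measurable_funB.
  exact: (measurableT_comp (measurable_indic (D := setT) mB) mt).
exact: measurable_indic.
Qed.

Lemma log_seminorm_integrandE (a p r : R) h :
  (\int[mu]_x (`|\1_(eucl_ball r) (x + h) - \1_(eucl_ball r) x| `^ p
      / eucl_norm h ^+ n * (ln (1 / eucl_norm h) `^ (1 - a))^-1)%:E =
   difference_integral p r h *
     ((eucl_norm h ^+ n)^-1 * log_weight a (eucl_norm h))%:E)%E.
Proof.
rewrite -ge0_integralZr//.
- apply: eq_integral => x _; rewrite -EFinM mulrA; congr (_ * _)%:E.
  by rewrite -powRN opprB.
- exact: measurable_indic_ball_difference.
- by rewrite lee_fin mulr_ge0 ?powR_ge0// invr_ge0 exprn_ge0 ?eucl_norm_ge0.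
Qed.

End logarithmic_weight.

(** * The two-sided estimate, by summation over shells *)

Theorem mainTheorem2 (R : realType) (d : nat) (d_ge1 : (1 <= d)%N)
    (p gamma : R) (p_gt0 : 0 < p) (gamma_gt0 : 0 < gamma) :
  exists c C : R, [/\ 0 < c, c <= C &
    forall r : R, 0 < r -> r < 1 / 6 ->
      ((c * r ^+ d * ln (1 / r) `^ (p * gamma))%:E
         <= log_seminorm gamma p (\1_(@eucl_ball R d r)) `^ p)%E /\
      (log_seminorm gamma p (\1_(@eucl_ball R d r)) `^ p
         <= (C * r ^+ d * ln (1 / r) `^ (p * gamma))%:E)%E].
Proof.
pose a := p * gamma; have a0 : 0 < a by rewrite mulr_gt0.
rewrite -/a.
pose l : R := ln (4 / 3).
have l0 : 0 < l by rewrite ln_gt0//; lra.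
have ln3 : 0 < ln (3 : R) by rewrite ln_gt0//; lra.
pose om : R := @eucl_ball_volume R d.
have om0 : 0 < om by exact: eucl_ball_volume_gt0.
pose q : R := 1 - (3 / 4) ^+ d.
(* [d >= 1] enters here: it gives each shell positive mass. *)
have q0 : 0 < q by rewrite subr_gt0 exprn_ilt1 -?lt0n//; lra.
pose rho := @shell_radius R.
have rho0 k : 0 < rho k by exact: shell_radius_gt0.
have [C1 C10 HC1] := damped_powR_sum_le a0.
pose wU : R := weight_upper a; have wU0 : 0 < wU by exact: weight_upper_gt0.
pose wL : R := weight_lower a; have wL0 : 0 < wL by exact: weight_lower_gt0.
pose dc : R := @difference_const R d.
have dc0 : 0 < dc by exact: difference_const_gt0.
(* In both constants [om * q] is the shell volume divided by [rho k ^+ d]. In [A], [(4/3)^d] is the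
   loss from replacing [|h|] by the inner radius; in [B], the second [om] and [(1/2)^d] come from
   the volume of [B_(r/2)]. The last factors convert [N^a] into [L^a]. *)
pose A : R := (4 / 3) ^+ d * om * q * wU * dc * C1 * l^-1 `^ a.
pose B : R := om * q * wL * om * (1 / 2) ^+ d * (1 + a)^-1 *
  (ln 3 + 4 * l)^-1 `^ a.
have A0 : 0 < A by rewrite !mulr_gt0 ?exprn_gt0 ?powR_gt0 ?invr_gt0//; lra.
have B0 : 0 < B.
  by rewrite !mulr_gt0 ?exprn_gt0 ?powR_gt0// ?invr_gt0//; lra.
exists B, (B + A); split => //; first by rewrite lerDl ltW.
move=> r r0 r6.
have r32 : 3 / 2 * r < 3^-1 by lra.
have r320 : 0 < 3 / 2 * r by lra.
have [N /andP[N1 N2]] := shell_radius_bracket r320 r32.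
rewrite -/rho in N1 N2.
(* The bound [r < 1/6] is what gives [3/2 * r < 1/4 = rho 1], so at least one full shell lies beyond
   [3/2 * r]. *)
have N0 : (0 < N)%N.
  by case: N N1 N2 => // + _; rewrite /rho /shell_radius expr1; lra.
have rd0 : 0 < r ^+ d by rewrite exprn_gt0.
set L := ln (1 / r).
have LN1 : N%:R * l <= L.
  have /= := @ln_inv_shell_radius R N; rewrite -/rho -/l => e.
  apply: (@le_trans _ _ (ln (1 / rho N))); first by rewrite e lerDr ltW.
  rewrite ler_ln ?posrE ?divr_gt0// !div1r lef_pV2 ?posrE//; lra.
(* Two more shells after [N+1] bring the radius below [r], since [(3/4)^2 * 3/2 = 27/32 < 1]; then
   [N >= 1] absorbs the additive constants. *)
have LN2 : L <= (ln 3 + 4 * l) * N%:R.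
  have /= := @ln_inv_shell_radius R (N + 3); rewrite -/rho -/l => e.
  apply: (@le_trans _ _ (ln (1 / rho (N + 3)%N))).
    rewrite ler_ln ?posrE ?divr_gt0// !div1r lef_pV2 ?posrE//.
    rewrite addn3 /rho !shell_radiusS.
    by move: N1; rewrite /rho !shell_radiusS; lra.
  have N1R : 1 <= N%:R :> R by rewrite ler1n.
  have := ler_wpM2l (ltW ln3) N1R.
  have := ler_wpM2l (ltW l0) N1R.
  rewrite e natrD; lra.
have L0 : 0 < L by apply: lt_le_trans LN1; rewrite mulr_gt0// ltr0n.
pose F (h : 'rV[R]_d) : \bar R := (difference_integral p r h *
  ((eucl_norm h ^+ d)^-1 * log_weight a (eucl_norm h))%:E)%E.
have W0 (h : 'rV[R]_d) :
    0 <= (eucl_norm h ^+ d)^-1 * log_weight a (eucl_norm h).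
  by rewrite mulr_ge0 ?powR_ge0// invr_ge0 exprn_ge0 ?eucl_norm_ge0.
have D0 (h : 'rV[R]_d) : (0 <= difference_integral p r h)%E.
  by apply: integral_ge0 => x _; rewrite lee_fin powR_ge0.
have F0 (h : 'rV[R]_d) : (0 <= F h)%E by rewrite mule_ge0// lee_fin.
have -> : (log_seminorm gamma p (\1_(@eucl_ball R d r)) `^ p =
    \int[@lebesgue_rV R d]_(h in eucl_ball (1 / 3)) F h)%E.
  have p1 : 1 / p * p = 1 by rewrite divfK ?gt_eqF.
  rewrite /log_seminorm -poweRrM p1 poweRe1.
    by apply: eq_integral => h _; rewrite log_seminorm_integrandE.
  by apply: integral_ge0 => h _; rewrite log_seminorm_integrandE; exact: F0.
have sh k (h : 'rV[R]_d) : shell k h ->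
    [/\ rho k.+1 <= eucl_norm h <= rho k, 0 < eucl_norm h,
      (rho k ^+ d)^-1 <= (eucl_norm h ^+ d)^-1 &
      (eucl_norm h ^+ d)^-1 <= (rho k.+1 ^+ d)^-1].
  move=> /shellP/andP[h1 h2].
  have h0 : 0 < eucl_norm h by exact: lt_le_trans h1.
  split => //; first by rewrite h1 ltW.
    by rewrite lef_pV2 ?posrE ?exprn_gt0// lerXn2r ?nnegrE ?ltW.
  by rewrite lef_pV2 ?posrE ?exprn_gt0// lerXn2r ?nnegrE// ltW.
split.
  (* Lower bound: only the shells [k < N] are kept, where [|h| >= rho (k+1) >= rho N > 3/2 * r]. *)
  pose c k := om * (r / 2) ^+ d * ((rho k ^+ d)^-1 * (wL * k.+1%:R `^ (a - 1))).
  have r20 : 0 <= r / 2 by rewrite divr_ge0// ltW.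
  have c0 k : 0 <= c k.
    by rewrite !mulr_ge0 ?(ltW om0) ?(ltW wL0) ?powR_ge0 ?invr_ge0 ?exprn_ge0
      ?(ltW (rho0 _)) ?r20.
  apply: le_trans (@integral_ball_ge_shells R d F c N F0 c0 _); last first.
    move=> k h kN hk; have [h1 h2 h3 _] := sh _ _ hk.
    have [w1 _] := log_weight_bounds a h1.
    rewrite /c EFinM /F; apply: lee_pmul; rewrite ?lee_fin//.
    - by rewrite mulr_ge0 ?(ltW om0)// exprn_ge0.
    - by rewrite !mulr_ge0 ?(ltW wL0) ?powR_ge0 ?invr_ge0 ?exprn_ge0
        ?(ltW (rho0 _)).
    - apply: difference_integral_ge_ball => //.
      apply: le_trans (ltW N2) _; case/andP: h1 => h1 _; apply: le_trans h1.
      exact: shell_radius_le.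
    - apply: ler_pM => //; last by rewrite mulr_ge0 ?(ltW wL0) ?powR_ge0.
      by rewrite invr_ge0 exprn_ge0 ?(ltW (rho0 _)).
  rewrite lee_fin.
  have [SN _] := powR_sum_bounds N a0.
  (* The factor [rho k ^+ d] of the shell volume cancels the kernel, leaving a pure power sum. *)
  rewrite (eq_bigr (fun k : 'I_N => om * q * wL * om * (1 / 2) ^+ d * r ^+ d *
     k.+1%:R `^ (a - 1))); last first.
    move=> k _; rewrite /c -/om -/q.
    rewrite exprMn div1r; have : rho k ^+ d != 0 by rewrite expf_neq0 ?gt_eqF.
    move: (rho k ^+ d) (_ `^ _) => x y x0; by field.
  rewrite -mulr_sumr; set K0 := om * q * wL * om * (1 / 2) ^+ d.
  have K00 : 0 < K0 by rewrite !mulr_gt0// exprn_gt0//; lra.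
  set S := \sum_(k < N) _ in SN *.
  have LN : (ln 3 + 4 * l)^-1 `^ a * L `^ a <= N%:R `^ a.
    rewrite -powRM ?(ltW L0)//; last by rewrite invr_ge0; lra.
    apply: ge0_ler_powR; rewrite ?nnegrE ?(ltW a0)//.
      by rewrite mulr_ge0 ?(ltW L0)// invr_ge0; lra.
    by rewrite ler_pdivrMl//; lra.
  have a10 : 0 < 1 + a by lra.
  have SN' : (1 + a)^-1 * ((ln 3 + 4 * l)^-1 `^ a * L `^ a) <= S.
    by rewrite ler_pdivrMl//; exact: le_trans SN.
  have -> : B * r ^+ d * L `^ a = K0 * r ^+ d *
      ((1 + a)^-1 * ((ln 3 + 4 * l)^-1 `^ a * L `^ a)).
    by rewrite /B -/K0; move: ((1 + a)^-1) (_^-1 `^ a) => x y; ring.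
  by rewrite ler_pM2l// mulr_gt0.
pose theta k : R := Num.min 1 (rho k / r).
have th01 k : 0 <= theta k <= 1.
  by rewrite /theta le_min ler01 ge_min lexx andbT/= divr_ge0// ltW.
(* The factor 2 is [4/3 * 3/2]: [rho N = 4/3 * rho (N+1) <= 2 r]. *)
have thN j : theta (N + j)%N <= 2 * (3 / 4) ^+ j.
  rewrite /theta ge_min; apply/orP; right.
  have qj0 : 0 < (3 / 4 : R) ^+ j by rewrite exprn_gt0//; lra.
  rewrite /rho shell_radiusD -/rho mulrAC ler_pM2r//.
  by rewrite ler_pdivrMr//; move: N1; rewrite /rho shell_radiusS -/rho; lra.
(* Upper bound: all shells contribute, with [|h|] at most [rho k] in the difference and at least
   [rho (k+1)] in the kernel. *)
pose c k := dc * r ^+ d * theta k *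
  ((rho k.+1 ^+ d)^-1 * (wU * k.+1%:R `^ (a - 1))).
have c0 k : 0 <= c k.
  have /andP[t0 _] := th01 k.
  by rewrite !mulr_ge0 ?(ltW dc0) ?(ltW wU0) ?(ltW rd0) ?powR_ge0 ?invr_ge0
    ?exprn_ge0 ?(ltW (rho0 _)).
apply: (@integral_ball_le_shells R d F c _ F0 _ c0).
- rewrite /F (_ : difference_integral p r 0 = 0%E) ?mul0e//.
  apply: integral0_eq => x _.
  by rewrite norm_indicB_powR// addr0 addbb.
- move=> k h hk; have [h1 h2 _ h3] := sh _ _ hk.
  have [_ w2] := log_weight_bounds a h1.
  rewrite /c EFinM /F; apply: lee_pmul; rewrite ?lee_fin//.
    apply: le_trans (difference_integral_le_min _ p_gt0 r0) _.
    rewrite lee_fin -/dc ler_pM2l ?mulr_gt0// /theta.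
    rewrite le_min !ge_min lexx/=; apply/orP; right.
    by rewrite ler_pM2r ?invr_gt0//; case/andP: h1.
  by apply: ler_pM => //; rewrite ?powR_ge0// invr_ge0 exprn_ge0// ltW.
move=> K; rewrite -/om -/q -/rho.
pose K1 := (4 / 3) ^+ d * om * q * wU * dc * r ^+ d.
have K10 : 0 < K1 by rewrite !mulr_gt0 ?exprn_gt0//; lra.
rewrite (eq_bigr (fun k : 'I_K => K1 * (theta k * k.+1%:R `^ (a - 1))));
    last first.
  move=> k _; rewrite /c /K1 /rho shell_radiusS -/rho.
  have rk : rho k ^+ d != 0 by rewrite expf_neq0 ?gt_eqF.
  rewrite [(3 / 4 * _) ^+ d]exprMn invfM -exprVn invf_div.
  move: (rho k ^+ d) (_ `^ _) (theta k) rk => x y z x0.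
  by field.
rewrite -mulr_sumr.
have := HC1 N theta N0 th01 thN K; set S := \sum_(k < K) _ => SN.
have NL : N%:R `^ a <= l^-1 `^ a * L `^ a.
  rewrite -powRM ?invr_ge0 ?(ltW L0) ?(ltW l0)//.
  apply: ge0_ler_powR; rewrite ?nnegrE ?(ltW a0)//.
    by rewrite mulr_ge0 ?invr_ge0 ?(ltW L0) ?(ltW l0).
  by rewrite ler_pdivlMl// mulrC.
have SL : S <= C1 * (l^-1 `^ a * L `^ a).
  by apply: le_trans SN _; rewrite ler_pM2l.
apply: (@le_trans _ _ (A * r ^+ d * L `^ a)).
  have -> : A * r ^+ d * L `^ a = K1 * (C1 * (l^-1 `^ a * L `^ a)).
    by rewrite /A /K1; move: (_^-1 `^ a) => y; ring.
  by rewrite ler_pM2l.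
by rewrite ler_wpM2r ?powR_ge0// ler_wpM2r ?(ltW rd0)// lerDr ltW.
Qed.
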